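(* Let $M$ satisfy $M^2=(1-s)(1-t)$. Then, as formal power series in $u$, $$H_0(s,t,q,u)=\frac{(1-s)\Big(\big(1-t\cosh_q(Mu)\big)\cosh_B(Mu;q)+t\sinh_q(Mu)\sinh_B(Mu;q)\Big)}{1-(s+t)\cosh_q(Mu)+st\,\mathrm{e}_q(Mu)\,\mathrm{e}_q(-Mu)},$$ $$H_1(s,t,q,u)=\frac{M\Big(\big(1-s\cosh_q(Mu)\big)\sinh_B(Mu;q)+s\sinh_q(Mu)\cosh_B(Mu;q)\Big)}{1-(s+t)\cosh_q(Mu)+st\,\mathrm{e}_q(Mu)\,\mathrm{e}_q(-Mu)}.$$
   Context: $\mathfrak{B}_n$ is the group of permutations $\pi$ of $\{\pm1,\dots,\pm n\}$ with $\pi(-i)=-\pi(i)$; write $\pi_i=\pi(i)$ and set $\pi_0=0$. For $\pi\in\mathfrak{B}_n$: $\mathrm{edes}_B(\pi)$ (resp. $\mathrm{odes}_B(\pi)$) is the number of even (resp. odd) indices $i\in\{0,1,\dots,n-1\}$ with $\pi_i>\pi_{i+1}$. The type B inversion number is $$\mathrm{inv}_B(\pi)=|\{1\le i<j\le n:\pi_i>\pi_j\}|+|\{1\le i<j\le n:-\pi_i>\pi_j\}|+|\{1\le i\le n:\pi_i<0\}|.$$ Define $B_n(s,t,q)=\sum_{\pi\in\mathfrak{B}_n}s^{\mathrm{edes}_B(\pi)}t^{\mathrm{odes}_B(\pi)}q^{\mathrm{inv}_B(\pi)}$ and $B_n(1,q)=\sum_{\pi\in\mathfrak{B}_n}q^{\mathrm{inv}_B(\pi)}$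 (with $B_0(s,t,q)=B_0(1,q)=1$), and $$H_0(s,t,q,u)=\sum_{n\ge0}B_{2n}(s,t,q)\frac{u^{2n}}{B_{2n}(1,q)},\qquad H_1(s,t,q,u)=\sum_{n\ge0}B_{2n+1}(s,t,q)\frac{u^{2n+1}}{B_{2n+1}(1,q)}.$$ $[i]_q=1+q+\cdots+q^{i-1}$, $[n]_q!=\prod_{i=1}^n[i]_q$, $\mathrm{e}_q(u)=\sum_{n\ge0}u^n/[n]_q!$, $\cosh_q(u)=\frac{\mathrm{e}_q(u)+\mathrm{e}_q(-u)}2$, $\sinh_q(u)=\frac{\mathrm{e}_q(u)-\mathrm{e}_q(-u)}2$. Also $\exp_B(u;q)=\sum_{n\ge0}u^n/B_n(1,q)$, $\cosh_B(u;q)=\frac{\exp_B(u;q)+\exp_B(-u;q)}2$, $\sinh_B(u;q)=\frac{\exp_B(u;q)-\exp_B(-u;q)}2$. Here $s,t,q$ are indeterminates and the identities are between formal power series in $u$ over the field $\mathbb{Q}(s,t,q)(M)$. *)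

(* Defs.v *)
From HB Require Import structures.
From mathcomp Require Import all_boot all_order all_algebra all_fingroup all_field.
From mathcomp Require Import mpoly ring.
From mathcomp Require boolp.

Set Implicit Arguments.
Unset Strict Implicit.
Unset Printing Implicit Defensive.

Import GRing.Theory Num.Theory.
Local Open Scope ring_scope.

(* Formal power series in one variable u: [f n] is the coefficient of u^n. *)
Record fps (K : Type) := FPS { fpscoef :> nat -> K }.

HB.instance Definition _ (K : Type) := boolp.gen_eqMixin (fps K).
HB.instance Definition _ (K : Type) := boolp.gen_choiceMixin (fps K).

Lemma fpsP (K : Type) (f g : fps K) : f =1 g -> f = g.
Proof.
case: f g => [f] [g] /= fg; congr FPS.
exact: boolp.functional_extensionality_dep.
Qed.

Section FpsRing.
Variable K : fieldType.
Implicit Types f g h : fps K.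

Definition fps0 : fps K := FPS (fun _ => 0).
Definition fps1 : fps K := FPS (fun n => (n == 0%N)%:R).
Definition fpsN f : fps K := FPS (fun n => - f n).
Definition fpsD f g : fps K := FPS (fun n => f n + g n).
Definition fpsM f g : fps K := FPS (fun n => \sum_(i < n.+1) f i * g (n - i)%N).
Definition fpsZ (a : K) f : fps K := FPS (fun n => a * f n).

Fact fpsDA : associative fpsD.
Proof. by move=> f g h; apply: fpsP => n /=; rewrite addrA. Qed.
Fact fpsDC : commutative fpsD.
Proof. by move=> f g; apply: fpsP => n /=; rewrite addrC. Qed.
Fact fps0D : left_id fps0 fpsD.
Proof. by move=> f; apply: fpsP => n /=; rewrite add0r. Qed.
Fact fpsND : left_inverse fps0 fpsN fpsD.
Proof. by move=> f; apply: fpsP => n /=; rewrite addNr. Qed.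

HB.instance Definition _ :=
  GRing.isZmodule.Build (fps K) fpsDA fpsDC fps0D fpsND.

Definition fps_trunc m f : {poly K} := \poly_(i < m) f i.

Lemma fpsM_trunc m f g n : (n < m)%N ->
  fpsM f g n = (fps_trunc m f * fps_trunc m g)`_n.
Proof.
move=> ltnm; rewrite coefM; apply: eq_bigr => i _.
rewrite !coef_poly (leq_ltn_trans (leq_subr _ _) ltnm).
by rewrite (leq_ltn_trans _ ltnm) // -ltnS.
Qed.

Fact fpsMC : commutative fpsM.
Proof.
by move=> f g; apply: fpsP => n; rewrite !(@fpsM_trunc n.+1) // mulrC.
Qed.

Fact fpsMA : associative fpsM.
Proof.
move=> f g h; apply: fpsP => n.
transitivity ((fps_trunc n.+1 f * (fps_trunc n.+1 g * fps_trunc n.+1 h))`_n).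
  rewrite coefM; apply: eq_bigr => i _; rewrite coef_poly ltn_ord.
  by rewrite -fpsM_trunc // ltnS leq_subr.
rewrite mulrA coefM; apply: eq_bigr => i _; rewrite -fpsM_trunc //.
by rewrite coef_poly ltnS leq_subr.
Qed.

Fact fps1M : left_id fps1 fpsM.
Proof.
move=> f; apply: fpsP => n /=; rewrite big_ord_recl /= mul1r subn0 big1 ?addr0 //.
by move=> i _; rewrite mul0r.
Qed.

Fact fpsMDl : left_distributive fpsM fpsD.
Proof.
move=> f g h; apply: fpsP => n /=; rewrite -big_split /=.
by apply: eq_bigr => i _; rewrite mulrDl.
Qed.

Fact fps1_neq0 : fps1 != 0.
Proof.
apply/eqP => /(congr1 (fun f : fps K => f 0%N)) /= /eqP.
by rewrite oner_eq0.
Qed.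

HB.instance Definition _ :=
  GRing.Zmodule_isComNzRing.Build (fps K) fpsMA fpsMC fps1M fpsMDl fps1_neq0.

Fact fpsZA a b f : fpsZ a (fpsZ b f) = fpsZ (a * b) f.
Proof. by apply: fpsP => n /=; rewrite mulrA. Qed.
Fact fps1Z : left_id 1 fpsZ.
Proof. by move=> f; apply: fpsP => n /=; rewrite mul1r. Qed.
Fact fpsZDr : right_distributive fpsZ +%R.
Proof. by move=> a f g; apply: fpsP => n /=; rewrite mulrDr. Qed.
Fact fpsZDl f : {morph fpsZ^~ f : a b / a + b}.
Proof. by move=> a b; apply: fpsP => n /=; rewrite mulrDl. Qed.

HB.instance Definition _ :=
  GRing.Zmodule_isLmodule.Build K (fps K) fpsZA fps1Z fpsZDr fpsZDl.

Fact fpsZMl (a : K) f g : a *: (f * g) = (a *: f) * g.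
Proof.
apply: fpsP => n /=; rewrite mulr_sumr.
by apply: eq_bigr => i _; rewrite mulrA.
Qed.

HB.instance Definition _ :=
  GRing.Lmodule_isLalgebra.Build K (fps K) fpsZMl.

Fact fpsZMr (a : K) f g : a *: (f * g) = f * (a *: g).
Proof. by rewrite mulrC fpsZMl mulrC. Qed.

HB.instance Definition _ :=
  GRing.Lalgebra_isAlgebra.Build K (fps K) fpsZMr.

(* The first n coefficients of the inverse of f, obtained by solving
   f * g = 1 degree by degree. *)
Fixpoint fps_inv_seq f (n : nat) : seq K :=
  if n is m.+1 then
    let s := fps_inv_seq f m in
    rcons s ((f 0%N)^-1 * ((m == 0%N)%:R - \sum_(i < m) s`_i * f (m - i)%N))
  else [::].

Definition fps_unit : {pred fps K} := fun f => f 0%N != 0.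

Definition fpsV f : fps K :=
  if f \in fps_unit then FPS (fun n => (fps_inv_seq f n.+1)`_n) else f.

Lemma size_fps_inv_seq f n : size (fps_inv_seq f n) = n.
Proof. by elim: n => //= n IHn; rewrite size_rcons IHn. Qed.

Lemma nth_fps_inv_seq f n i :
  (i < n)%N -> (fps_inv_seq f n)`_i = (fps_inv_seq f i.+1)`_i.
Proof.
elim: n => // n IHn; rewrite ltnS leq_eqVlt => /predU1P[-> // | ltin].
by rewrite -IHn //= nth_rcons size_fps_inv_seq ltin.
Qed.

Fact fpsVM : {in fps_unit, left_inverse 1 fpsV *%R}.
Proof.
move=> f Uf; rewrite /fpsV Uf; apply: fpsP => n.
transitivity (\sum_(i < n.+1) (fps_inv_seq f n.+1)`_i * f (n - i)%N).
  by apply: eq_bigr => i _; rewrite nth_fps_inv_seq.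
rewrite big_ord_recr subnn; under eq_bigr => i _ do
  rewrite /= nth_rcons size_fps_inv_seq ltn_ord.
rewrite /= nth_rcons size_fps_inv_seq ltnn eqxx.
by rewrite mulrAC mulVf // mul1r addrC subrK.
Qed.

Fact fps_unitP f g : g * f = 1 -> fps_unit f.
Proof.
move=> /(congr1 (fun h : fps K => h 0%N)) /=; rewrite big_ord1 /= => gf1.
by apply/eqP => f0; move/eqP: gf1; rewrite f0 mulr0 eq_sym oner_eq0.
Qed.

Fact fpsV_out : {in [predC fps_unit], fpsV =1 id}.
Proof. by move=> f /negbTE; rewrite /fpsV => ->. Qed.

HB.instance Definition _ :=
  GRing.ComNzRing_hasMulInverse.Build (fps K) fpsVM fps_unitP fpsV_out.

Lemma fps_unitE f : (f \is a GRing.unit) = (f 0%N != 0).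
Proof. by []. Qed.

(* The series f(cu). *)
Definition dilate (c : K) f : fps K := FPS (fun n => c ^+ n * f n).

End FpsRing.

(* The ground set {+-1, ..., +-n}: the pair (b, i) stands for i + 1 when
   b = false and for -(i + 1) when b = true. *)
Definition sidx (n : nat) : finType := (bool * 'I_n)%type.

Definition sopp (n : nat) (x : sidx n) : sidx n := (~~ x.1, x.2).

Definition sint (n : nat) (x : sidx n) : int := (-1) ^+ x.1 * (x.2.+1)%:Z.

Definition signed_perms (n : nat) : {set {perm sidx n}} :=
  [set p : {perm sidx n} | [forall x, p (sopp x) == sopp (p x)]].

(* p_i for 0 <= i <= n, with p_0 = 0. *)
Definition sentry (n : nat) (p : {perm sidx n}) (i : 'I_n.+1) : int :=
  if unlift ord0 i is Some j then sint (p (false, j)) else 0.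

Section Statistics.
Variables (n : nat) (p : {perm sidx n}).

(* For i : 'I_n, [widen_ord (leqnSn n) i] is i and [lift ord0 i] is i + 1,
   both seen in {0, ..., n}. *)
Definition desB (i : 'I_n) : bool :=
  sentry p (widen_ord (leqnSn n) i) > sentry p (lift ord0 i).

Definition edesB : nat := #|[set i : 'I_n | ~~ odd i & desB i]|.

Definition odesB : nat := #|[set i : 'I_n | odd i & desB i]|.

Definition invB : nat :=
  (#|[set ij : 'I_n.+1 * 'I_n.+1 |
        (1 <= ij.1 < ij.2)%N & (sentry p ij.1 > sentry p ij.2)%R]|
   + #|[set ij : 'I_n.+1 * 'I_n.+1 |
        (1 <= ij.1 < ij.2)%N & (- sentry p ij.1 > sentry p ij.2)%R]|
   + #|[set i : 'I_n.+1 | (1 <= i)%N & (sentry p i < 0)%R]|)%N.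

End Statistics.

Section Series.
Variable K : fieldType.
Implicit Types s t q : K.

Definition polB (n : nat) s t q : K :=
  \sum_(p in signed_perms n) s ^+ edesB p * t ^+ odesB p * q ^+ invB p.

Definition polB1 (n : nat) q : K := \sum_(p in signed_perms n) q ^+ invB p.

Lemma signed_perms0 : signed_perms 0 = [set 1%g].
Proof.
apply/setP => p; rewrite !inE.
have -> : p = 1%g by apply/permP => -[b []].
by rewrite eqxx; apply/forallP => -[b []].
Qed.

Lemma polB_0 s t q : polB 0 s t q = 1.
Proof.
rewrite /polB signed_perms0 big_set1 /edesB /odesB /invB !eq_card0 ?mulr1 //.
- by case=> -[|?] ?; rewrite !inE.
- by case=> -[[|?] ?] -[[|?] ?]; rewrite !inE.
- by case=> -[[|?] ?] -[[|?] ?]; rewrite !inE.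
- by case.
- by case.
Qed.

Lemma polB1_0 q : polB1 0 q = 1.
Proof.
rewrite -(polB_0 1 1 q); apply: eq_bigr => p _.
by rewrite !expr1n !mul1r.
Qed.

Definition H0 s t q : fps K :=
  FPS (fun n => if odd n then 0 else polB n s t q / polB1 n q).

Definition H1 s t q : fps K :=
  FPS (fun n => if odd n then polB n s t q / polB1 n q else 0).

Definition qint (q : K) (i : nat) : K := \sum_(j < i) q ^+ j.

Definition qfact (q : K) (n : nat) : K := \prod_(1 <= i < n.+1) qint q i.

Definition exp_q (q : K) : fps K := FPS (fun n => (qfact q n)^-1).
Definition cosh_q (q : K) : fps K := 2^-1 *: (exp_q q + dilate (-1) (exp_q q)).
Definition sinh_q (q : K) : fps K := 2^-1 *: (exp_q q - dilate (-1) (exp_q q)).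

Definition exp_B (q : K) : fps K := FPS (fun n => (polB1 n q)^-1).
Definition cosh_B (q : K) : fps K := 2^-1 *: (exp_B q + dilate (-1) (exp_B q)).
Definition sinh_B (q : K) : fps K := 2^-1 *: (exp_B q - dilate (-1) (exp_B q)).

Definition denH s t q (M : K) : fps K :=
  1 - (s + t) *: dilate M (cosh_q q)
    + (s * t) *: (dilate M (exp_q q) * dilate (- M) (exp_q q)).

End Series.

(* The field Q(s,t,q); s, t, q are the indeterminates 'X_0, 'X_1, 'X_2. *)
Definition Qstq : fieldType := {fraction {mpoly rat[3]}}.

Definition indet (L : fieldExtType Qstq) (i : 'I_3) : L :=
  (FracField.tofrac ('X_i : {mpoly rat[3]}) : Qstq)%:A.

Lemma indet_neq1 (L : fieldExtType Qstq) (i : 'I_3) : indet L i != 1.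
Proof.
rewrite /indet -[X in _ != X]scale1r (inj_eq (fmorph_inj (in_alg L))).
rewrite -[X in _ != X]tofrac1 tofrac_eq.
apply/eqP => /(congr1 (fun p : {mpoly rat[3]} => p@_(U_(i))%MM)).
rewrite mcoeffX eqxx mcoeff1 mnm1_eq0 => /eqP.
by rewrite oner_eq0.
Qed.

Lemma denH_unit (K : fieldType) (s t q M : K) :
  2 != 0 :> K -> s != 1 -> t != 1 -> denH s t q M \is a GRing.unit.
Proof.
move=> two s1 t1; rewrite fps_unitE /denH /=.
rewrite big_ord1 /= !expr0 !mul1r /qfact big_geq // invr1 mulr1.
rewrite -[1 + 1]/(2 : K) mulVf //.
have -> : 1 - (s + t) * 1 + s * t * 1 = (1 - s) * (1 - t).
  by ring.
by rewrite mulf_neq0 // subr_eq0 eq_sym.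
Qed.

(* In particular, over an extension of Q(s,t,q), [_ / denH s t q M] is a genuine
   division (recall that x^-1 = x when x is not a unit). *)
Lemma denH_indet_unit (L : fieldExtType Qstq) (M : L) :
  denH (indet L 0) (indet L 1) (indet L 2%:R) M \is a GRing.unit.
Proof.
apply: denH_unit (indet_neq1 _ _) (indet_neq1 _ _).
rewrite -(rmorph_nat (in_alg L)) fmorph_eq0.
rewrite -(rmorph_nat (@FracField.tofrac {mpoly rat[3]})) tofrac_eq0.
by rewrite -(rmorph_nat (@mpolyC 3 rat)) mpolyC_eq0.
Qed.

(* Main.v *)
Require Import Defs.
From mathcomp Require Import all_boot all_order all_algebra all_fingroup all_field.
From mathcomp Require Import mpoly ring zify.

Set Implicit Arguments.
Unset Strict Implicit.
Unset Printing Implicit Defensive.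

Import Order.TTheory GRing.Theory Num.Theory.
Local Open Scope ring_scope.

(** The identities come from two linear relations between the two series, which
    express inclusion-exclusion on descents.  A position [i]
    has weight [w_i] at a descent, equal to [s] or [t] by parity, and weight
    [1 = w_i + (1 - w_i)] at an ascent.  So every position is either left free,
    with factor [w_i], or forced to be an ascent, with factor [1 - w_i].
    Sorting by the last free position [j], a signed permutation of [n] splits
    into a weighted signed permutation of [j] and an increasing word of length
    [n - j].  The inversion generating function of the possible increasing ends
    is [B_n(1,q) / (B_j(1,q) [n-j]_q!)], so that with
    [a_n = B_n(s,t,q) / B_n(1,q)]
    one gets
      [a_n = \sum_(j < n) w_j a_j \prod_(j < i < n) (1 - w_i) / [n-j]_q!
             + \prod_(i < n) (1 - w_i) / B_n(1,q)]
    (the last term: only the identity has no descent at all).  Since the weights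
    alternate, the products of [1 - w_i] are powers of [M], up to one leftover
    factor; separating even and odd indices gives
      [(1 - s C) H0 = (1 - s) CB + t (1 - s) / M S H1],
      [(1 - t C) H1 = M SB + s (1 - t) / M S H0],
    where [C, S, CB, SB] are the hyperbolic series at [M u] ([H0_eq], [H1_eq]).
    The determinant [(1 - s C) (1 - t C) - s t S^2] is the denominator of the
    theorem, because [e_q(Mu) e_q(-Mu) = (C + S) (C - S)].

    The combinatorial input is a single insertion step.  A signed permutation of
    [n + 1] is a signed permutation of [n] together with its last entry
    ([sum_append]), and if that entry has [c] larger elements in
    [{+-1, ..., +-(n+1)}], it adds exactly [c] inversions ([invB_append]).
    Whether the new position is a descent depends only on the numbers [c'] and
    [c] attached to the last two entries: the condition is
    [c' < c - [c > n]] ([stretch_scode_lt]).  So everything becomes a sum over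
    sequences of integers [c_i < 2 i], and the count of increasing ends becomes
    a sum [incr_sum] over sequences with [c_i >= c_(i+1) - [c_(i+1) > i]].  Its
    product formula [incr_sum_prod] follows from a Pascal-type recurrence
    ([incr_sum_Pascal]), which is proved for all truncated sums at once since
    only the truncated sums are stable under the recursion. *)

(** * Inserting a last entry *)

Lemma sidxP n (x y : sidx n) : x = y <-> x.1 = y.1 /\ x.2 = y.2.
Proof. by split=> [->|[]] //; case: x y => [? ?] [? ?] /= -> ->. Qed.

(** The entries of [p] are moved apart, keeping their signs and their order, so
    that the absolute value of [y] becomes vacant; [y] then takes the new last
    position. *)
Definition append_fun n (y : sidx n.+1) (p : {perm sidx n}) (x : sidx n.+1) :
    sidx n.+1 :=
  if unlift ord_max x.2 is Some k then ((p (x.1, k)).1, lift y.2 (p (x.1, k)).2)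
  else (x.1 (+) y.1, y.2).

Lemma append_fun_inj n y p : injective (@append_fun n y p).
Proof.
move=> [b i] [b' i'] /sidxP; rewrite /append_fun /=.
case: unliftP => [k ->|->]; case: unliftP => [k' ->|->] /= [e1 e2].
- have /perm_inj/sidxP /= [-> ->] // : p (b, k) = p (b', k').
  by apply/sidxP; split=> //; apply: lift_inj e2.
- by case/eqP: e2; rewrite eq_sym (negbTE (neq_lift _ _)).
- by case/eqP: e2; rewrite (negbTE (neq_lift _ _)).
- by rewrite (addIb e1).
Qed.

Definition append n (y : sidx n.+1) (p : {perm sidx n}) : {perm sidx n.+1} :=
  perm (@append_fun_inj n y p).

Lemma append_lift n (y : sidx n.+1) p b k :
  append y p (b, lift ord_max k) = ((p (b, k)).1, lift y.2 (p (b, k)).2).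
Proof. by rewrite permE /append_fun /= liftK. Qed.

Lemma append_last n (y : sidx n.+1) p b : append y p (b, ord_max) = (b (+) y.1, y.2).
Proof. by rewrite permE /append_fun /= unlift_none. Qed.

Lemma signed_permsP n (p : {perm sidx n}) :
  reflect (forall b i, p (~~ b, i) = sopp (p (b, i))) (p \in signed_perms n).
Proof.
rewrite inE; apply: (iffP forallP) => [sp b i | sp [b i]].
  by move/eqP: (sp (b, i)).
exact/eqP/sp.
Qed.

Lemma signed_perm_abs_inj n (p : {perm sidx n}) b :
  p \in signed_perms n -> injective (fun k => (p (b, k)).2).
Proof.
move=> /signed_permsP sp k k' eqk.
case: (eqVneq (p (b, k)).1 (p (b, k')).1) => [eqb | neqb].
  by have /perm_inj/sidxP[] : p (b, k) = p (b, k') by apply/sidxP.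
suff /perm_inj/sidxP[] : p (b, k) = p (~~ b, k') by [].
rewrite sp; apply/sidxP; split=> //=.
by case: (p _).1 (p _).1 neqb => [] [].
Qed.

Lemma append_signed n (y : sidx n.+1) p :
  (append y p \in signed_perms n.+1) = (p \in signed_perms n).
Proof.
apply/signed_permsP/signed_permsP => sp b i.
  have := sp b (lift ord_max i); rewrite !append_lift => /sidxP[/= e1 /lift_inj e2].
  exact/sidxP.
case: (unliftP ord_max i) => [k ->|->].
  by rewrite !append_lift sp.
by rewrite !append_last; apply/sidxP; split=> //=; case: b; case: (y.1).
Qed.

(** Removing the last entry and closing the gap that it leaves among the absolute
    values inverts [append]. *)
Lemma append_surj n (p : {perm sidx n.+1}) : p \in signed_perms n.+1 ->
  exists s, p = append (p (false, ord_max)) s.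
Proof.
move=> sp; set y := p _.
have y1 b : p (b, ord_max) = (b (+) y.1, y.2).
  case: b; last by rewrite addFb -/y -surjective_pairing.
  by have /signed_permsP/(_ false) /= -> := sp.
have neq b k : y.2 != (p (b, lift ord_max k)).2.
  have -> : y.2 = (p (b, ord_max)).2 by rewrite y1.
  by rewrite (inj_eq (signed_perm_abs_inj sp)) neq_lift.
pose f (x : sidx n) : sidx n :=
  ((p (x.1, lift ord_max x.2)).1, odflt x.2 (unlift y.2 (p (x.1, lift ord_max x.2)).2)).
have fE b k : lift y.2 (f (b, k)).2 = (p (b, lift ord_max k)).2.
  by rewrite /f /=; case: unliftP (neq b k) => [j -> //| -> /eqP].
have f_inj : injective f.
  move=> [b k] [b' k'] /sidxP[e1 /(congr1 (lift y.2))]; rewrite !fE => e2.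
  suff /perm_inj/sidxP /= [-> /lift_inj->] :
    p (b, lift ord_max k) = p (b', lift ord_max k') by [].
  exact/sidxP.
exists (perm f_inj); apply/permP => -[b i].
case: (unliftP ord_max i) => [k ->|->]; last by rewrite append_last y1.
by rewrite append_lift !permE fE -surjective_pairing.
Qed.

Lemma append_inj n (y y' : sidx n.+1) p p' :
  append y p = append y' p' -> (y, p) = (y', p').
Proof.
move=> eqa; have := congr1 (fun f : {perm _} => f (false, ord_max)) eqa.
rewrite !append_last => /sidxP /= [e1 e2].
have {e1 e2} eqy : y = y' by apply/sidxP.
rewrite -{}eqy in eqa *; congr pair; apply/permP => -[b k].
have := congr1 (fun f : {perm _} => f (b, lift ord_max k)) eqa.
by rewrite !append_lift => /sidxP[/= e1 /lift_inj e2]; apply/sidxP.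
Qed.

Lemma sum_append (V : nmodType) n (F : {perm sidx n.+1} -> V) :
  \sum_(p in signed_perms n.+1) F p =
    \sum_(y : sidx n.+1) \sum_(p in signed_perms n) F (append y p).
Proof.
rewrite pair_big_dep /=.
have -> : signed_perms n.+1 =
    [set append x.1 x.2 | x in [pred x : _ * _ | x.2 \in signed_perms n]].
  apply/setP => p; apply/idP/imsetP => [sp | [x sx ->]].
    have [s eqp] := append_surj sp; exists (p (false, ord_max), s) => //.
    by rewrite inE /= -(append_signed (p (false, ord_max))) -eqp.
  by rewrite append_signed.
rewrite big_imset /=; last by move=> [y p] [y' p'] _ _ /append_inj.
by apply: eq_bigl => -[].
Qed.

(** * Effect of an insertion on descents and inversions *)

(** The map which moves the entries apart, on integers.  It is odd and strictly
    increasing, hence preserves every comparison that enters the statistics. *)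
Definition stretch (h : nat) (z : int) : int :=
  if h%:Z < z then z + 1 else if z < - h%:Z then z - 1 else z.

Lemma stretch_lt h : {mono stretch h : x y / x < y}.
Proof. by move=> x y; rewrite /stretch; do !case: ifP; lia. Qed.

Lemma stretchN h x : stretch h (- x) = - stretch h x.
Proof. by rewrite /stretch; do !case: ifP; lia. Qed.

Lemma stretch0 h : stretch h 0 = 0.
Proof. by rewrite /stretch; do !case: ifP; lia. Qed.

Lemma sint_lift n (y : sidx n.+1) b k :
  sint (b, lift y.2 k) = stretch y.2 (sint (b, k)).
Proof.
rewrite /sint /stretch /= /bump.
by case: b; rewrite ?expr0 ?expr1 ?mul1r ?mulN1r; case: leqP => *; do !case: ifP; lia.
Qed.

Lemma sentry0 n (p : {perm sidx n}) : sentry p ord0 = 0.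
Proof. by rewrite /sentry unlift_none. Qed.

Lemma sentryS n (p : {perm sidx n}) j : sentry p (lift ord0 j) = sint (p (false, j)).
Proof. by rewrite /sentry liftK. Qed.

Lemma sentry_append n (y : sidx n.+1) p (i : 'I_n.+1) :
  sentry (append y p) (widen_ord (leqnSn n.+1) i) = stretch y.2 (sentry p i).
Proof.
case: (unliftP ord0 i) => [k ->|->].
  have -> : widen_ord (leqnSn n.+1) (lift ord0 k) = lift ord0 (lift ord_max k).
    by apply: val_inj; rewrite /= [bump n k]/bump leqNgt ltn_ord.
  by rewrite !sentryS append_lift sint_lift; case: (p _).
have -> : widen_ord (leqnSn n.+1) ord0 = ord0 by apply: val_inj.
by rewrite !sentry0 stretch0.
Qed.

Lemma sentry_append_max n (y : sidx n.+1) p : sentry (append y p) ord_max = sint y.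
Proof.
have -> : ord_max = lift ord0 ord_max :> 'I_n.+2 by apply: val_inj.
by rewrite sentryS append_last; case: (y) => -[].
Qed.

Lemma desB_append n (y : sidx n.+1) p (k : 'I_n) :
  desB (append y p) (widen_ord (leqnSn n) k) = desB p k.
Proof.
rewrite /desB sentry_append.
have -> : lift ord0 (widen_ord (leqnSn n) k) = widen_ord (leqnSn n.+1) (lift ord0 k).
  exact: val_inj.
by rewrite sentry_append stretch_lt.
Qed.

Lemma desB_append_max n (y : sidx n.+1) p :
  desB (append y p) ord_max = (sint y < stretch y.2 (sentry p ord_max)).
Proof.
rewrite /desB -sentry_append -(sentry_append_max y p); congr (_ < _).
by congr sentry; apply: val_inj.
Qed.

(** Sorting the inversions by their right end isolates those that involve the last
    entry. *)
Lemma invB_sum n (p : {perm sidx n}) :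
  invB p = (\sum_(j < n.+1) (\sum_(i < n.+1) (1 <= i < j) *
     ((sentry p j < sentry p i)%R + (sentry p j < - sentry p i)%R)
     + (1 <= j) * (sentry p j < 0)%R))%N.
Proof.
have card_sum (T : finType) (P : pred T) : #|[set x | P x]| = (\sum_x P x)%N.
  by rewrite -sum1dep_card big_mkcond; apply: eq_bigr => x _; case: (P x).
have pair_sum (P : 'I_n.+1 * 'I_n.+1 -> bool) :
    (\sum_x P x = \sum_j \sum_i P (i, j))%N.
  by rewrite exchange_big pair_big; apply: eq_bigr => -[].
rewrite /invB !card_sum !pair_sum -!big_split /=.
apply: eq_bigr => j _.
congr addn; last by rewrite mulnb.
by rewrite -big_split; apply: eq_bigr => i _; rewrite mulnDr !mulnb.
Qed.

(** The number of elements of [{+-1, ..., +-n}] that exceed [y]. *)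
Definition scode n (y : sidx n) : nat := if y.1 then (n + y.2)%N else (n.-1 - y.2)%N.

(** Among [m] and [-m], every earlier entry of absolute value [m] contributes each
    that exceeds [y], and [y < 0] contributes the case [m = |y|]; this counts
    every signed value above [y] once, whatever the signs and the order of the
    earlier entries. *)
Lemma sum_below_sint n (p : {perm sidx n}) (y : sidx n.+1) : p \in signed_perms n ->
  (\sum_(k < n) ((sint y < stretch y.2 (sint (p (false, k))))%R
     + (sint y < - stretch y.2 (sint (p (false, k))))%R)
   + (sint y < 0)%R)%N = scode y.
Proof.
move=> sp.
pose F (m : 'I_n) := (if y.1 then 1 + (m < y.2) else (y.2 <= m))%N.
(* Both signs occur in each summand, so it depends on an absolute value only. *)
have -> : (\sum_(k < n) ((sint y < stretch y.2 (sint (p (false, k))))%R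
     + (sint y < - stretch y.2 (sint (p (false, k))))%R) = \sum_(k < n) F k)%N.
  rewrite [RHS](reindex_inj (@signed_perm_abs_inj _ _ false sp)).
  apply: eq_bigr => k _; case: (p _) => b m; rewrite /F -sint_lift /sint /= /bump.
  case: (y) => b' i /=; case: b; case: b'; rewrite ?expr0 ?expr1; lia.
have count_lt i m : (\sum_(k < m) (k < i) = minn i m)%N.
  by elim: m => [|m IHm]; rewrite ?big_ord0 ?big_ord_recr ?IHm /=; lia.
have count_ge i m : (\sum_(k < m) (i <= k) = m - i)%N.
  by elim: m => [|m IHm]; rewrite ?big_ord0 ?big_ord_recr ?IHm /=; lia.
rewrite {}/F /scode; case: y => -[] i /=; have := ltn_ord i.
  rewrite big_split /= sum1_card card_ord count_lt /sint /= ?expr1; lia.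
rewrite count_ge /sint /= ?expr0; lia.
Qed.

Lemma invB_append n (y : sidx n.+1) p :
  p \in signed_perms n -> invB (append y p) = (invB p + scode y)%N.
Proof.
move=> sp; rewrite !invB_sum big_ord_recr /=; congr addn.
  apply: eq_bigr => j _; rewrite big_ord_recr /= (ltnNge n.+1) (ltnW (ltn_ord j)) /=.
  rewrite mul0n addn0 sentry_append -[in X in (_ < X)%R](stretch0 y.2) stretch_lt; congr addn.
  by apply: eq_bigr => i _; rewrite sentry_append -stretchN !stretch_lt.
rewrite big_ord_recr /= ltnn mul0n addn0 sentry_append_max mul1n -(sum_below_sint y sp).
congr addn; rewrite big_ord_recl /= mul0n add0n; apply: eq_bigr => k _.
by rewrite ltnS ltn_ord mul1n sentry_append sentryS.
Qed.

(** Passing from [n + 1] to [n + 2] absolute values, the number of elements above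
    the previous last entry [x] grows by one for each of [y] and [-y] above it.
    In terms of the old number, [y] lies below [x] when
    [scode x < scode y] for positive [y]; for negative [y] the element [-y] is
    always among those above [y], whence the shift by one. *)
Lemma stretch_scode_lt n (y : sidx n.+2) (x : sidx n.+1) :
  (sint y < stretch y.2 (sint x)) = (scode x < scode y - (n.+1 < scode y))%N.
Proof.
case: y x => -[] i [[] k]; have := ltn_ord i; have := ltn_ord k;
  rewrite -sint_lift /scode /sint /= /bump ?expr0 ?expr1; lia.
Qed.

(** A last entry is determined by the number of elements above it, which takes
    each value below [2 n] once. *)
Lemma sum_scode (V : nmodType) n (f : nat -> V) :
  \sum_(y : sidx n) f (scode y) = \sum_(c < n.*2) f c.
Proof.
rewrite -(pair_bigA_idem (addr0 _) (fun b i => f (scode (b, i)))) big_bool /=.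
rewrite -addnn big_split_ord /= addrC; congr (_ + _).
rewrite (reindex_inj rev_ord_inj); apply: eq_bigr => i _ /=.
by rewrite /scode /=; congr f; have := ltn_ord i; lia.
Qed.

(** * Generating functions refined by the last entry *)

Section Weights.
Variables (K : fieldType) (w : nat -> K) (q : K).

Definition weight n (p : {perm sidx n}) : K :=
  (\prod_(i < n) (if desB p i then w i else 1)) * q ^+ invB p.

Lemma weight_append n (y : sidx n.+1) p : p \in signed_perms n ->
  weight (append y p) =
    weight p * (if sint y < stretch y.2 (sentry p ord_max) then w n else 1) *
    q ^+ scode y.
Proof.
move=> sp; rewrite /weight big_ord_recr /= desB_append_max invB_append // exprD.
under eq_bigr do rewrite desB_append.
by rewrite mulrA; congr (_ * _); rewrite mulrAC.
Qed.

Definition Bsum n : K := \sum_(p in signed_perms n) weight p.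

(** The truncation by the last entry is what makes the recursion close: a forced
    ascent after [p] is a lower bound on the code of its last entry. *)
Definition Btail n m : K :=
  \sum_(p in signed_perms n.+1 | (m <= scode (p (false, ord_max)))%N) weight p.

Lemma Btail0 n : Btail n 0 = Bsum n.+1.
Proof. by apply: eq_bigl => p; rewrite andbT. Qed.

Lemma Btail_sum n m : Btail n m =
  \sum_(y : sidx n.+1 | (m <= scode y)%N)
    q ^+ scode y *
    \sum_(p in signed_perms n)
       weight p * (if sint y < stretch y.2 (sentry p ord_max) then w n else 1).
Proof.
rewrite /Btail big_mkcondr sum_append [RHS]big_mkcond; apply: eq_bigr => y _.
rewrite mulr_sumr.
under eq_bigr do rewrite append_last -surjective_pairing.
case: ifP => _; last by rewrite big1.
by apply: eq_bigr => p sp; rewrite weight_append // mulrC.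
Qed.

(** The weight of the new position, [w] at a descent and [1] at an ascent, is
    [w] in all cases plus [1 - w] at an ascent.  The [w] part decouples from the
    last entry of [p]; the other part sees only a tail. *)
Lemma Btail_rec n m : Btail n.+1 m =
  \sum_(m <= c < n.+2.*2) q ^+ c *
    (w n.+1 * Bsum n.+1 + (1 - w n.+1) * Btail n (c - (n.+1 < c))).
Proof.
pose f c := q ^+ c *
    (w n.+1 * Bsum n.+1 + (1 - w n.+1) * Btail n (c - (n.+1 < c))).
rewrite -/(f _) (big_nat_widenl m 0) // big_mkord big_mkcond /=.
rewrite -(sum_scode _ (fun c => if (m <= c)%N then f c else 0)) Btail_sum big_mkcond.
apply: eq_bigr => y _; case: ifP => // _; congr (_ * _).
rewrite /Bsum /Btail big_mkcondr !mulr_sumr -big_split /=; apply: eq_bigr => p sp.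
have -> : ord_max = lift ord0 ord_max :> 'I_n.+2 by apply: val_inj.
by rewrite sentryS stretch_scode_lt; case: ltnP => _; ring.
Qed.
End Weights.

(** * Counting increasing ends *)

Section IncreasingEnds.
Variables (K : fieldType) (q : K).

(** The sum of [q ^ (c_(j+1) + ... + c_(j+k))] over the codes of the last [k]
    entries when these entries are increasing and follow [j] others, with
    [c_(j+k) >= m].  An empty end satisfies every bound [m]. *)
Fixpoint incr_sum j k m : K :=
  if k is k'.+1 then
    \sum_(m <= c < (j + k').+1.*2) q ^+ c * incr_sum j k' (c - (j + k' < c))%N
  else 1.
Arguments incr_sum : simpl never.

Lemma incr_sum0 j m : incr_sum j 0 m = 1. Proof. by []. Qed.

Lemma incr_sumS j k m : incr_sum j k.+1 m =
  \sum_(m <= c < (j + k).+1.*2) q ^+ c * incr_sum j k (c - (j + k < c))%N.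
Proof. by []. Qed.

(** Combinatorially, this removes the largest absolute value [j + k + 1], which
    cannot be that of a positive end entry when [m > 0].  Either it belongs to
    one of the first [j] entries, and makes an inversion with each of the
    [k + 1] last ones, or it is that of a negative entry, necessarily the first
    of the end, which is involved in [2 j + k + 1] inversions.  The proof only uses the
    recursion on the last code [c]: replacing [c] by [c - 1] and [j + k] by
    [j + k - 1] commutes with the shift [c - [c > j + k]]. *)
Lemma incr_sum_Pascal j k m : (0 < m < (j + k).+1.*2)%N ->
  incr_sum j k.+1 m = (0 < j)%:R * q ^+ k.+1 * incr_sum j.-1 k.+1 m.-1
                  + q ^+ (j + k + j).+1 * incr_sum j k m.-1.
Proof.
elim: k m => [|k IHk] m /andP[m_gt0 m_lt]; rewrite incr_sumS.
  rewrite addn0 in m_lt *.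
  under eq_bigr do rewrite incr_sum0 mulr1.
  rewrite doubleS big_nat_recr /=; last by lia.
  rewrite incr_sum0 mulr1 addnn; congr (_ + _).
  case: j m_lt => [|j] m_lt; first by rewrite big_geq // !mul0r.
  rewrite /= mul1r incr_sumS addn0 -[m in LHS]prednK // big_add1 /= mulr_sumr.
  by apply: eq_bigr => i _; rewrite incr_sum0 mulr1 exprS expr1.
rewrite doubleS big_nat_recr /=; last by lia.
(* The largest code, that of the most negative value, cannot follow an entry of
   an increasing end. *)
have top M : ((j + k.+1).*2 <= M)%N -> incr_sum j k.+1 M = 0.
  by move=> M_ge; rewrite incr_sumS big_geq //; lia.
rewrite [incr_sum j k.+1 _]top ?mulr0 ?addr0; last by lia.
case: m m_gt0 m_lt => // m _ m_lt; rewrite big_add1 /=.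
have -> : (0 < j)%:R * q ^+ k.+2 * incr_sum j.-1 k.+2 m =
    \sum_(m <= c < (j + k.+1).*2) q ^+ c.+1 *
      ((0 < j)%:R * q ^+ k.+1 * incr_sum j.-1 k.+1 (c - (j + k < c))).
  case: j {IHk m_lt top} => [|j]; first by rewrite !mul0r big1 // => c _; rewrite !mul0r mulr0.
  rewrite /= incr_sumS !addnS mulr_sumr; apply: eq_bigr => c _.
  by rewrite [q ^+ k.+2]exprS [q ^+ c.+1]exprS; ring.
rewrite incr_sumS -(addnS j k) mulr_sumr -big_split /= !big_nat.
apply: eq_bigr => c /andP[_ c_lt].
rewrite IHk; last by lia.
have -> : (c.+1 - (j + k.+1 < c.+1)).-1 = (c - (j + k < c))%N by lia.
by rewrite (addnS j k) addSn !exprS; ring.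
Qed.

(** The full sum is the one over [m > 0] plus the contribution of a last entry
    with code [0], that is, a largest entry, which has no inversion. *)
Lemma incr_sum_rec j k : incr_sum j k.+1 0 =
  (0 < j)%:R * q ^+ k.+1 * incr_sum j.-1 k.+1 0
  + (1 + q ^+ (j + k + j).+1) * incr_sum j k 0.
Proof.
rewrite incr_sumS big_ltn // -incr_sumS incr_sum_Pascal // sub0n expr0; ring.
Qed.

Lemma qintD a b : qint q (a + b) = qint q a + q ^+ a * qint q b.
Proof.
by rewrite /qint big_split_ord mulr_sumr; congr (_ + _); apply: eq_bigr => i _; rewrite -exprD.
Qed.

(** The [q]-analogue of [2 * 4 * ... * (2 n)], the inversion generating function of
    all signed permutations of [n]. *)
Definition qdfact n : K := \prod_(1 <= i < n.+1) qint q i.*2.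

Lemma qdfactS n : qdfact n.+1 = qdfact n * qint q n.+1.*2.
Proof. by rewrite /qdfact big_nat_recr. Qed.

Lemma qfactS n : qfact q n.+1 = qfact q n * qint q n.+1.
Proof. by rewrite /qfact big_nat_recr. Qed.

(** The product satisfies the recurrence [incr_sum_rec] because
    [[2 (j + k + 1)] = [k + 1] + q^(k+1) ([2 j] + q^(2 j) [k + 1])]. *)
Lemma incr_sum_prod j k : incr_sum j k 0 * qfact q k * qdfact j = qdfact (j + k).
Proof.
elim: k j => [j|k IHk]; first by rewrite addn0 incr_sum0 /qfact big_geq // !mul1r.
have step j : (0 < j)%:R * incr_sum j.-1 k.+1 0 * qfact q k.+1 * qdfact j =
     qint q j.*2 * qdfact (j + k) ->
   incr_sum j k.+1 0 * qfact q k.+1 * qdfact j = qdfact (j + k.+1).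
  move=> IHj; rewrite incr_sum_rec addnS qdfactS.
  have -> : (j + k).+1.*2 = (k.+1 + (j.*2 + k.+1))%N by lia.
  rewrite !qintD !mulrDr !mulrA.
  have -> : ((0 < j)%:R * q ^+ k.+1 * incr_sum j.-1 k.+1 0
      + (1 + q ^+ (j + k + j).+1) * incr_sum j k 0) * qfact q k.+1 * qdfact j =
    q ^+ k.+1 * ((0 < j)%:R * incr_sum j.-1 k.+1 0 * qfact q k.+1 * qdfact j)
    + (1 + q ^+ (j + k + j).+1) * qint q k.+1 * (incr_sum j k 0 * qfact q k * qdfact j).
    by rewrite qfactS; ring.
  rewrite IHj IHk.
  have -> : (j + k + j).+1 = (k.+1 + j.*2)%N by lia.
  by rewrite exprD; ring.
elim=> [|j IHj]; apply: step; first by rewrite /qint big_ord0 !mul0r.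
by rewrite /= mul1r qdfactS mulrA IHj addnS mulrC.
Qed.

End IncreasingEnds.
Arguments incr_sum : simpl never.

(** * Inclusion-exclusion on descents *)

Section Blocks.
Variables (K : fieldType) (w : nat -> K) (q : K).
Local Notation Bsum := (Bsum w q).
Local Notation Btail := (Btail w q).
Local Notation incr_sum := (incr_sum q).
Implicit Types n m : nat.

Lemma Bsum0 : Bsum 0 = 1.
Proof.
rewrite /Bsum signed_perms0 big_set1 /weight big_ord0 invB_sum big_ord1 big_ord1 /=.
by rewrite mulr1.
Qed.

(** The first entry is compared with [0] and not with a previous entry, so this case
    does not follow the pattern of [Btail_rec]. *)
Lemma Btail_init m : Btail 0 m =
  \sum_(m <= c < 2) q ^+ c * (w 0 + (1 - w 0) * (c == 0%N)%:R).
Proof.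
rewrite (big_nat_widenl m 0) // big_mkord big_mkcond /=.
pose f c := q ^+ c * (w 0 + (1 - w 0) * (c == 0%N)%:R).
rewrite -(sum_scode 1 (fun c => if (m <= c)%N then f c else 0)) Btail_sum big_mkcond.
apply: eq_bigr => y _; case: ifP => // _; congr (_ * _).
rewrite -[RHS]mul1r -[X in _ = X * _]Bsum0 mulr_suml; apply: eq_bigr => p _; congr (_ * _).
have -> : ord_max = ord0 :> 'I_1 by apply: val_inj.
rewrite sentry0 stretch0 /sint /scode; case: y => -[] [[|//] ?] /=; rewrite ?expr0 ?expr1 //=.
  by rewrite mulr0 addr0.
by rewrite mulr1 addrC subrK.
Qed.

(** The index [j] is the last free position: beyond it, every step is a forced
    ascent, and the ends of these forced ascents are summed by [incr_sum].  The
    last term has no free position; its only permutation is the identity,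
    whose last entry has code [0]. *)
Lemma Btail_blocks n m : Btail n m =
  \sum_(j < n.+1) w j * Bsum j * \prod_(j.+1 <= i < n.+1) (1 - w i) *
     incr_sum j (n.+1 - j) m
  + \prod_(0 <= i < n.+1) (1 - w i) * (m == 0%N)%:R.
Proof.
elim: n m => [|n IHn] m.
  rewrite big_ord1 Btail_init Bsum0 big_geq // big_nat1 subn0 incr_sumS /=.
  rewrite !mulr1 mulr_sumr; under eq_bigr do rewrite mulrDr.
  rewrite big_split /=; congr (_ + _).
    by apply: eq_bigr => i _; rewrite ?incr_sum0 ?mulr1 mulrC.
  case: m => [|m]; first by rewrite big_nat_recl // big_nat1 /= !expr0 !mulr0 addr0 mul1r mulr1.
  by rewrite mulr0 big_nat big1 // => -[|c] //; rewrite ?mulr0.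
rewrite Btail_rec big_ord_recr /= [\prod_(n.+2 <= i < n.+2) _]big_geq // mulr1.
under eq_bigr do rewrite IHn !mulrDr addrA [X in X + _]addrC.
rewrite !big_split /=; congr (_ + _ + _).
- under [RHS]eq_bigr => j _.
    rewrite (subSn (ltnW (ltn_ord j))) big_nat_recr /=; last exact: ltn_ord.
    rewrite incr_sumS mulr_sumr (subnKC (ltnW (ltn_ord j))).
    over.
  rewrite exchange_big /=; apply: eq_bigr => c _; rewrite !mulr_sumr.
  apply: eq_bigr => j _; ring.
- rewrite subSnn incr_sumS mulr_sumr addn0; apply: eq_bigr => c _; rewrite incr_sum0; ring.
(* After a code 0, an ascent forces the code 0 again. *)
have tail0 m' : (0 < m')%N -> \sum_(m' <= c < n.+2.*2) q ^+ c * ((1 - w n.+1) *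
    (\prod_(0 <= i < n.+1) (1 - w i) * (c - (n.+1 < c) == 0)%N%:R)) = 0.
  move=> m'_gt0; apply: big1_seq => c /=; rewrite mem_index_iota => /andP[c_ge _].
  suff /negbTE-> : (c - (n.+1 < c) != 0)%N by rewrite !mulr0.
  by rewrite -lt0n; lia.
case: m => [|m]; last by rewrite tail0 ?mulr0.
by rewrite big_ltn // tail0 // sub0n eqxx [in RHS]big_nat_recr //= expr0; ring.
Qed.

Lemma Bsum_blocks n : Bsum n =
  \sum_(j < n) w j * Bsum j * \prod_(j.+1 <= i < n) (1 - w i) * incr_sum j (n - j) 0
  + \prod_(0 <= i < n) (1 - w i).
Proof.
case: n => [|n]; first by rewrite big_ord0 big_geq // Bsum0 add0r.
by rewrite -Btail0 Btail_blocks mulr1.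
Qed.

End Blocks.

(** * The series *)

Section Series.
Variables (K : fieldType) (s t q M : K).

Definition parity_weight i : K := if odd i then t else s.

Lemma polB_Bsum n : polB n s t q = Bsum parity_weight q n.
Proof.
have expr_card (x : K) (P : pred 'I_n) : x ^+ #|[set i | P i]| = \prod_(i | P i) x.
  by rewrite prodr_const; congr (_ ^+ _); apply: eq_card => i; rewrite inE.
apply: eq_bigr => p _; rewrite /edesB /odesB !expr_card; congr (_ * _).
rewrite [X in X * _]big_mkcond [X in _ * X]big_mkcond -big_split; apply: eq_bigr => i _ /=.
by rewrite /parity_weight; case: odd; case: desB; rewrite ?mul1r ?mulr1.
Qed.

Lemma polB1_qdfact n : polB1 n q = qdfact q n.
Proof.
have -> : polB1 n q = Bsum (fun=> 1) q n.
  apply: eq_bigr => p _; rewrite /weight big1 ?mul1r // => i _; exact: if_same.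
elim: n => [|n IHn]; first by rewrite Bsum0 /qdfact big_geq.
rewrite Bsum_blocks big_ord_recr /= big_geq // big1 => [|j _].
  rewrite big_nat_recr //= subrr mulr0 !addr0 add0r mul1r mulr1 IHn subSnn.
  rewrite incr_sumS qdfactS addn0 big_mkord; congr (_ * _).
  by apply: eq_bigr => i _; rewrite incr_sum0 mulr1.
by rewrite big_nat_recr /= ?subrr ?mulr0 ?mul0r // ltn_ord.
Qed.

(** Consecutive factors pair up to [M ^ 2]. *)
Lemma prod_parity_weight (hM : M ^+ 2 = (1 - s) * (1 - t)) j k :
  \prod_(j <= i < j + k) (1 - parity_weight i) =
  if odd k then M ^+ k.-1 * (1 - parity_weight j) else M ^+ k.
Proof.
elim: k => [|k IHk]; first by rewrite addn0 big_geq.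
rewrite addnS big_nat_recr ?leq_addr //= IHk; have [odd_k | even_k] := boolP (odd k).
  rewrite /= -mulrA; have -> : (1 - parity_weight j) * (1 - parity_weight (j + k)) = M ^+ 2.
    by rewrite hM /parity_weight oddD odd_k addbT; case: odd => //=; rewrite mulrC.
  by rewrite -exprD addn2 prednK // lt0n; case: (k) odd_k.
by rewrite /parity_weight oddD (negbTE even_k) addbF.
Qed.

Hypothesis q_int : forall i, qint q i.+1 != 0.

Lemma qfact_neq0 n : qfact q n != 0.
Proof. by elim: n => [|n IHn]; rewrite ?qfactS ?mulf_neq0 // /qfact big_geq ?oner_neq0. Qed.

Lemma qdfact_neq0 n : qdfact q n != 0.
Proof.
elim: n => [|n IHn]; first by rewrite /qdfact big_geq ?oner_neq0.
by rewrite qdfactS doubleS mulf_neq0.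
Qed.

Let a n := polB n s t q / polB1 n q.

(** The factor [1 - w n] makes each product one factor longer, so that its length
    [n - j] is the power of [u] that it accompanies. *)
Lemma ratio_blocks n : (1 - parity_weight n) * a n =
  \sum_(j < n) parity_weight j * a j *
     (\prod_(j.+1 <= i < n.+1) (1 - parity_weight i) / qfact q (n - j))
  + \prod_(0 <= i < n.+1) (1 - parity_weight i) / polB1 n q.
Proof.
rewrite {1}/a polB_Bsum Bsum_blocks [_ / polB1 n q]mulrDl mulrDr; congr (_ + _); last first.
  by rewrite big_nat_recr //= mulrA [(1 - _) * _]mulrC.
rewrite mulr_suml mulr_sumr; apply: eq_bigr => j _.
rewrite /a polB_Bsum !polB1_qdfact big_nat_recr ?ltn_ord //=.
have := incr_sum_prod q j (n - j); rewrite (subnKC (ltnW (ltn_ord j))) => <-.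
have := qdfact_neq0 j; have := qfact_neq0 (n - j).
have : incr_sum q j (n - j) 0 != 0.
  apply: contraNneq (qdfact_neq0 n) => sum0.
  have := incr_sum_prod q j (n - j); rewrite (subnKC (ltnW (ltn_ord j))) => <-.
  by rewrite sum0 !mul0r.
by move=> B_neq0 f_neq0 g_neq0; field; rewrite B_neq0 f_neq0 g_neq0.
Qed.

End Series.

Section Coef.
Variables (K : fieldType) (two_neq0 : 2 != 0 :> K).
Implicit Types f g : fps K.

Lemma fps_even_part f n : (2^-1 *: (f + dilate (-1) f)) n = if odd n then 0 else f n.
Proof.
rewrite /= -signr_odd; case: odd; rewrite ?expr1 ?expr0 ?mulN1r ?subrr ?mulr0 //.
by rewrite mul1r -mulr2n -[f n *+ 2]mulr_natl mulKf.
Qed.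

Lemma fps_odd_part f n : (2^-1 *: (f - dilate (-1) f)) n = if odd n then f n else 0.
Proof.
rewrite /= -signr_odd; case: odd; rewrite ?expr1 ?expr0 ?mulN1r ?mul1r ?subrr ?mulr0 //.
by rewrite opprK -mulr2n -[f n *+ 2]mulr_natl mulKf.
Qed.

Variables (s t q M : K).
Local Notation C := (dilate M (cosh_q q)).
Local Notation S := (dilate M (sinh_q q)).
Local Notation CB := (dilate M (cosh_B q)).
Local Notation SB := (dilate M (sinh_B q)).

Lemma dilate_exp_q : dilate M (exp_q q) = C + S.
Proof.
apply: fpsP => n; rewrite -[RHS]/(M ^+ n * cosh_q q n + M ^+ n * sinh_q q n).
by rewrite fps_even_part fps_odd_part /=; case: odd; rewrite mulr0 ?addr0 ?add0r.
Qed.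

Lemma dilateN_exp_q : dilate (- M) (exp_q q) = C - S.
Proof.
apply: fpsP => n; rewrite -[RHS]/(M ^+ n * cosh_q q n - M ^+ n * sinh_q q n).
rewrite fps_even_part fps_odd_part /= exprNn -signr_odd.
by case: odd; rewrite mulr0 ?expr0 ?expr1 ?mul1r ?mulN1r ?subr0 ?sub0r ?mulNr.
Qed.

Lemma fps_mul_low f g n : g 0%N = 0 -> (f * g) n = \sum_(i < n) f i * g (n - i)%N.
Proof.
by move=> g0; rewrite [LHS]big_ord_recr /= subnn g0 mulr0 addr0.
Qed.

Hypotheses (q_int : forall i, qint q i.+1 != 0) (hM : M ^+ 2 = (1 - s) * (1 - t)).
Variable r : K.

Lemma cosh_coef n : C n = if odd n then 0 else M ^+ n / qfact q n.
Proof. by rewrite -[LHS]/(M ^+ n * cosh_q q n) fps_even_part; case: odd; rewrite ?mulr0. Qed.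

Lemma sinh_coef n : S n = if odd n then M ^+ n / qfact q n else 0.
Proof. by rewrite -[LHS]/(M ^+ n * sinh_q q n) fps_odd_part; case: odd; rewrite ?mulr0. Qed.

Lemma cosh1_coef0 : (C - 1) 0%N = 0.
Proof. by rewrite -[LHS]/(C 0%N - 1) cosh_coef /qfact big_geq //= invr1 mulr1 subrr. Qed.

Lemma cosh1_coef n : (0 < n)%N -> (C - 1) n = C n.
Proof. by case: n => // n _; rewrite -[LHS]/(C n.+1 - 0) subr0. Qed.

Lemma H0_coef n : H0 s t q n = if odd n then 0 else polB n s t q / polB1 n q.
Proof. by []. Qed.

Lemma H1_coef n : H1 s t q n = if odd n then polB n s t q / polB1 n q else 0.
Proof. by []. Qed.

(** At an even index [n], the even [j] in [ratio_blocks] give the terms of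
    [H0 * (C - 1)] and the odd [j] those of [H1 * S]; in the latter the product
    has odd length, and its unpaired factor [1 - s] turns a power of [M] into
    [r = (1 - s) / M] times the next power. *)
Lemma H0_eq : r * M = 1 - s ->
  (1 - s) *: H0 s t q =
    (1 - s) *: CB + s *: (H0 s t q * (C - 1)) + (t * r) *: (H1 s t q * S).
Proof.
move=> rM; apply: fpsP => n.
rewrite -[LHS]/((1 - s) * H0 s t q n) H0_coef.
rewrite -[RHS]/((1 - s) * (M ^+ n * cosh_B q n) + s * (H0 s t q * (C - 1)) n
                + (t * r) * (H1 s t q * S) n).
rewrite !fps_mul_low ?cosh1_coef0 ?sinh_coef // fps_even_part -addrA !mulr_sumr -big_split.
have [odd_n | even_n] := boolP (odd n).
  rewrite !mulr0 add0r big1 // => i _.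
  rewrite cosh1_coef ?subn_gt0 // cosh_coef sinh_coef oddB ?(ltnW (ltn_ord i)) //
    H0_coef H1_coef odd_n.
  by case: odd; rewrite /= ?mul0r ?mulr0 ?addr0.
have := ratio_blocks s t q_int n; rewrite {1}/parity_weight (negbTE even_n) => ->.
rewrite addrC; congr (_ + _); last first.
  have := prod_parity_weight hM 0 n.+1; rewrite add0n => ->.
  by rewrite /= even_n /parity_weight /=; ring.
apply: eq_bigr => j _; rewrite cosh1_coef ?subn_gt0 // cosh_coef sinh_coef H0_coef H1_coef.
have le_jn := ltnW (ltn_ord j).
have -> : \prod_(j.+1 <= i < n.+1) (1 - parity_weight s t i) =
    \prod_(j.+1 <= i < j.+1 + (n - j)) (1 - parity_weight s t i) by rewrite addSn subnKC.
rewrite (prod_parity_weight hM) oddB // (negbTE even_n) addFb /parity_weight /=.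
case: odd => /=; last by ring.
rewrite mul0r mulr0 add0r -rM.
have -> : M ^+ (n - j) = M * M ^+ (n - j).-1 by rewrite -exprS prednK ?subn_gt0.
ring.
Qed.

Lemma H1_eq : r * M = 1 - t ->
  (1 - t) *: H1 s t q =
    M *: SB + t *: (H1 s t q * (C - 1)) + (s * r) *: (H0 s t q * S).
Proof.
move=> rM; apply: fpsP => n.
rewrite -[LHS]/((1 - t) * H1 s t q n) H1_coef.
rewrite -[RHS]/(M * (M ^+ n * sinh_B q n) + t * (H1 s t q * (C - 1)) n
                + (s * r) * (H0 s t q * S) n).
rewrite !fps_mul_low ?cosh1_coef0 ?sinh_coef // fps_odd_part -addrA !mulr_sumr -big_split.
have [odd_n | even_n] := boolP (odd n); last first.
  rewrite !mulr0 add0r big1 // => i _.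
  rewrite cosh1_coef ?subn_gt0 // cosh_coef sinh_coef oddB ?(ltnW (ltn_ord i)) //
    H0_coef H1_coef (negbTE even_n).
  by case: odd; rewrite /= ?mul0r ?mulr0 ?addr0.
have := ratio_blocks s t q_int n; rewrite {1}/parity_weight odd_n => ->.
rewrite addrC; congr (_ + _); last first.
  have := prod_parity_weight hM 0 n.+1; rewrite add0n => ->.
  by rewrite /= odd_n /= exprS; ring.
apply: eq_bigr => j _; rewrite cosh1_coef ?subn_gt0 // cosh_coef sinh_coef H0_coef H1_coef.
have le_jn := ltnW (ltn_ord j).
have -> : \prod_(j.+1 <= i < n.+1) (1 - parity_weight s t i) =
    \prod_(j.+1 <= i < j.+1 + (n - j)) (1 - parity_weight s t i) by rewrite addSn subnKC.
rewrite (prod_parity_weight hM) oddB // odd_n /parity_weight /=.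
case: odd => /=; first by ring.
rewrite mul0r mulr0 add0r -rM.
have -> : M ^+ (n - j) = M * M ^+ (n - j).-1 by rewrite -exprS prednK ?subn_gt0.
ring.
Qed.
End Coef.

(** Elimination in the system [H0_eq], [H1_eq]; the quantities [rho], [rho'] are
    [(1 - s) / M] and [(1 - t) / M], inverse to each other. *)
Lemma solve_2x2 (R : comUnitRingType) (a b c h cb hb rho rho' mu h0 h1 : R) :
  1 - (a + b) * c + a * b * ((c + h) * (c - h)) \is a GRing.unit ->
  rho * rho' = 1 -> rho' * mu = 1 - b -> rho * mu = 1 - a ->
  (1 - a) * h0 = (1 - a) * cb + a * (h0 * (c - 1)) + b * rho * (h1 * h) ->
  (1 - b) * h1 = mu * hb + b * (h1 * (c - 1)) + a * rho' * (h0 * h) ->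
  h0 = (1 - a) * ((1 - b * c) * cb + b * (h * hb)) /
       (1 - (a + b) * c + a * b * ((c + h) * (c - h))) /\
  h1 = mu * ((1 - a * c) * hb + a * (h * cb)) /
       (1 - (a + b) * c + a * b * ((c + h) * (c - h))).
Proof.
set D := (X in X \is a _) => uD rr rM' rM E0 E1.
have {}E0 : h0 * (1 - a * c) = (1 - a) * cb + b * rho * (h1 * h).
  have -> : h0 * (1 - a * c) = (1 - a) * h0 - a * (h0 * (c - 1)) by ring.
  by rewrite E0; ring.
have {}E1 : h1 * (1 - b * c) = mu * hb + a * rho' * (h0 * h).
  have -> : h1 * (1 - b * c) = (1 - b) * h1 - b * (h1 * (c - 1)) by ring.
  by rewrite E1; ring.
have mu_rho' : (1 - a) * rho' = mu by rewrite -rM mulrAC rr mul1r.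
split; apply: (canRL (mulrK uD)).
  have -> : h0 * D = h0 * (1 - a * c) * (1 - b * c) - a * b * h ^+ 2 * h0.
    by rewrite /D; ring.
  have -> : h0 * (1 - a * c) * (1 - b * c) =
      (1 - a) * cb * (1 - b * c) + b * rho * h * (h1 * (1 - b * c)).
    by rewrite E0; ring.
  rewrite E1.
  have -> : b * rho * h * (mu * hb + a * rho' * (h0 * h)) =
      b * h * (rho * mu * hb + rho * rho' * a * (h0 * h)) by ring.
  by rewrite rM rr; ring.
have -> : h1 * D = h1 * (1 - b * c) * (1 - a * c) - a * b * h ^+ 2 * h1.
  by rewrite /D; ring.
have -> : h1 * (1 - b * c) * (1 - a * c) =
    mu * hb * (1 - a * c) + a * rho' * h * (h0 * (1 - a * c)).
  by rewrite E1; ring.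
rewrite E0.
have -> : a * rho' * h * ((1 - a) * cb + b * rho * (h1 * h)) =
    a * h * ((1 - a) * rho' * cb + rho * rho' * b * (h1 * h)) by ring.
by rewrite mu_rho' rr; ring.
Qed.

Section Solve.
Variables (K : fieldType) (s t q M : K).
Hypotheses (two_neq0 : 2 != 0 :> K) (s1 : s != 1) (t1 : t != 1).
Hypotheses (q_int : forall i, qint q i.+1 != 0) (hM : M ^+ 2 = (1 - s) * (1 - t)).
Local Notation C := (dilate M (cosh_q q)).
Local Notation S := (dilate M (sinh_q q)).
Local Notation CB := (dilate M (cosh_B q)).
Local Notation SB := (dilate M (sinh_B q)).

Theorem H0_H1_formula :
  H0 s t q = (1 - s) *: ((1 - t *: C) * CB + t *: (S * SB)) / denH s t q M /\
  H1 s t q = M *: ((1 - s *: C) * SB + s *: (S * CB)) / denH s t q M.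
Proof.
have uD := denH_unit q M two_neq0 s1 t1.
have M0 : M != 0 by rewrite -sqrf_eq0 hM mulf_neq0 // subr_eq0 eq_sym.
have rM : (1 - s) / M * M = 1 - s by rewrite mulfVK.
have r'M : (1 - t) / M * M = 1 - t by rewrite mulfVK.
have rr' : (1 - s) / M * ((1 - t) / M) = 1.
  by rewrite mulf_div -hM -expr2 divff // expf_neq0.
move: ((1 - s) / M) ((1 - t) / M) rM r'M rr' => r r' rM r'M rr'.
have := H1_eq two_neq0 q_int hM r'M; have := H0_eq two_neq0 q_int hM rM.
move: uD; rewrite /denH dilate_exp_q // dilateN_exp_q // => uD.
(* Scalars become constant series, so that the system is one over the
   commutative ring of series. *)
pose io : {rmorphism K -> fps K} := in_alg (fps K).
have ioE a (f : fps K) : a *: f = io a * f by rewrite -[io a]/(a%:A) mulr_algl.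
have := congr1 io rM; have := congr1 io r'M; have := congr1 io rr'.
move: uD; rewrite !ioE !(rmorphM, rmorphB, rmorphD, rmorph1).
move: (io s) (io t) (io r) (io r') (io M) (H0 _ _ _) (H1 _ _ _).
move: (C) (S) (CB) (SB) => c h cb hb a b rho rho' mu h0 h1 uD rr rM' r'M' E0 E1.
exact: solve_2x2 E0 E1.
Qed.
End Solve.

(** * The indeterminates *)

Lemma poly_in_ext_neq0 (L : fieldExtType Qstq) (p : {mpoly rat[3]}) :
  p != 0 -> ((FracField.tofrac p : Qstq)%:A : L) != 0.
Proof. by move=> p0; rewrite (fmorph_eq0 (in_alg L)) tofrac_eq0. Qed.

Lemma ext_two_neq0 (L : fieldExtType Qstq) : 2 != 0 :> L.
Proof.
have := @poly_in_ext_neq0 L 2; rewrite -(rmorph_nat (@mpolyC 3 rat)) mpolyC_eq0 => /(_ isT).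
by rewrite !rmorph_nat scaler_nat.
Qed.

Lemma qint_indet_neq0 (L : fieldExtType Qstq) i n : qint (indet L i) n.+1 != 0.
Proof.
have -> : qint (indet L i) n.+1 =
    (FracField.tofrac (\sum_(j < n.+1) 'X_i ^+ j : {mpoly rat[3]}) : Qstq)%:A.
  rewrite rmorph_sum scaler_suml; apply: eq_bigr => j _.
  by rewrite rmorphXn /= -[RHS]/(in_alg L _) rmorphXn.
(* The constant term of the polynomial [1 + X + ... + X^n] is 1. *)
apply: poly_in_ext_neq0; apply/eqP => /(congr1 (meval (fun=> 0))).
rewrite raddf_sum big_ord_recl /= big1 => [|j _].
  by rewrite expr0 meval1 meval0 addr0 => /eqP; rewrite oner_eq0.
by rewrite rmorphXn /= mevalXU exprS mul0r.
Qed.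

Theorem theorem5 (L : fieldExtType Qstq) (M : L) :
  let s := indet L 0 in
  let t := indet L 1 in
  let q := indet L 2%:R in
  M ^+ 2 = (1 - s) * (1 - t) ->
  H0 s t q =
    (1 - s) *: ((1 - t *: dilate M (cosh_q q)) * dilate M (cosh_B q)
                + t *: (dilate M (sinh_q q) * dilate M (sinh_B q)))
    / (1 - (s + t) *: dilate M (cosh_q q)
         + (s * t) *: (dilate M (exp_q q) * dilate (- M) (exp_q q)))
  /\
  H1 s t q =
    M *: ((1 - s *: dilate M (cosh_q q)) * dilate M (sinh_B q)
          + s *: (dilate M (sinh_q q) * dilate M (cosh_B q)))
    / (1 - (s + t) *: dilate M (cosh_q q)
         + (s * t) *: (dilate M (exp_q q) * dilate (- M) (exp_q q))).
Proof.
move=> s t q hM.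
exact: (H0_H1_formula (ext_two_neq0 L) (indet_neq1 L _) (indet_neq1 L _)
                  (qint_indet_neq0 L _) hM).
Qed.
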